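(* Let $n=2$ and let $\mathcal D$ be a permutation-invariant probability distribution on payoffs of bimatrix constant-sum games. Let $\mathcal X\in\{\mathcal O,\mathcal P\}$. Then for every NE approximator $f$, $$\mathbb E_{u\sim\mathcal D}\Big[\sum_{i}\mathcal E_i((\mathcal Xf)(u),u)\Big]\ \le\ \mathbb E_{u\sim\mathcal D}\Big[\sum_{i}\mathcal E_i(f(u),u)\Big],$$ where the sums run over the two players $i\in\{1,2\}$.
   Context: There are $n=2$ players with finite action sets $\mathcal A_i=\{1,\dots,m_i\}$; $\mathcal A=\mathcal A_1\times\mathcal A_2$. A payoff is $u=(u_1,u_2)$ with $u_i:\mathcal A\to[0,1]$; $\mathcal U$ is the set of payoffs. The game is constant-sum if $u_1+u_2\equiv c$ on $\mathcal A$ for a constant $c$. A product strategy is $\sigma=(\sigma_1,\sigma_2)$ with $\sigma_i\in\Delta\mathcal A_i$; $u_i(\sigma)=\sum_{a}\sigma_1(a_1)\sigma_2(a_2)u_i(a)$. The exploitability of player $i$ is $\mathcal E_i(\sigma,u)=\max_{a_i\in\mathcal A_i}u_i(a_i,\sigma_{-i})-u_i(\sigma)$. An NE approximator is a (tacitly measurable) map $f:\mathcal U\to\Delta\mathcal A_1\times\Delta\mathcal A_2$, with $f(u)_i$ player $i$'s strategy (outputs need not be equilibria). Permutations: $\mathcal G_i$ is the group of all bijections $\rho_i:\mathcal A_i\to\mathcal A_i$. $\rho_iu$ is the payoff with $(\rho_iu)_j(a_i,a_{-i})=u_j(\rho_i^{-1}(a_i),a_{-i})$ for all $j$; $(\rho_i\sigma_i)(a_i)=\sigma_i(\rho_i^{-1}(a_i))$.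 $\mathcal D$ is permutation-invariant if for every $i$ and $\rho_i\in\mathcal G_i$, $u\sim\mathcal D$ implies $\rho_iu\sim\mathcal D$. Orbit averaging: $(\mathcal O_if)(u)_i=f(u)_i$ and $(\mathcal O_if)(u)_j=\frac1{|\mathcal A_i|!}\sum_{\rho_i\in\mathcal G_i}f(\rho_iu)_j$ for $j\ne i$; $(\mathcal P_if)(u)_i=\frac1{|\mathcal A_i|!}\sum_{\rho_i\in\mathcal G_i}\rho_i^{-1}f(\rho_iu)_i$ and $(\mathcal P_if)(u)_j=f(u)_j$ for $j\neq i$. $\mathcal O=\mathcal O_1\circ\mathcal O_2$ and $\mathcal P=\mathcal P_1\circ\mathcal P_2$. *)

(* Defs.v *)
From HB Require Import structures.
From mathcomp Require Import all_boot all_order all_algebra.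
From mathcomp Require Import fingroup perm.
From mathcomp Require Import all_classical all_reals all_analysis.

Set Implicit Arguments.
Unset Strict Implicit.
Unset Printing Implicit Defensive.

Import Order.TTheory GRing.Theory Num.Theory.

Local Open Scope classical_set_scope.
Local Open Scope ring_scope.

(* Player i in {1, 2} has the nonempty action set 'I_(m_i).+1; the matrix entry
   [A a1 a2] is indexed by player 1's action a1 and player 2's action a2. *)

Section Payoffs.
Variables (R : realType) (m1 m2 : nat).

Definition is_payoff (u : 'M[R]_(m1.+1, m2.+1) * 'M[R]_(m1.+1, m2.+1)) : bool :=
  [forall a1, forall a2,
    (0 <= u.1 a1 a2 <= 1) && (0 <= u.2 a1 a2 <= 1)].

Record payoff := Payoff {
  payoff_val :> 'M[R]_(m1.+1, m2.+1) * 'M[R]_(m1.+1, m2.+1);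
  payoffP : is_payoff payoff_val }.

HB.instance Definition _ := [isSub for payoff_val].
HB.instance Definition _ := [Choice of payoff by <:].

Lemma is_payoff0 : is_payoff (0, 0).
Proof. by apply/forallP => a1; apply/forallP => a2; rewrite !mxE lexx ler01. Qed.

HB.instance Definition _ := isPointed.Build payoff (Payoff is_payoff0).

(* Generators of the Borel sigma-algebra of [0,1]^(2 |A_1| |A_2|): the
   preimages of Borel subsets of R under the coordinate maps. *)
Definition payoff_cylinders : set (set payoff) :=
  \bigcup_(a in [set: 'I_m1.+1 * 'I_m2.+1])
    (preimage_set_system setT (fun u : payoff => u.1 a.1 a.2) measurable `|`
     preimage_set_system setT (fun u : payoff => u.2 a.1 a.2) measurable).

HB.instance Definition _ :=
  Measurable.copy payoff (g_sigma_algebraType payoff_cylinders).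

(* The constant may depend on the game [u]. *)
Definition constant_sum (u : payoff) : Prop :=
  exists c : R, forall a1 a2, u.1 a1 a2 + u.2 a1 a2 = c.

End Payoffs.

Section Mixed.
Variables (R : realType) (m : nat).

Definition is_mixed (s : {ffun 'I_m.+1 -> R}) : bool :=
  [forall a, 0 <= s a] && (\sum_a s a == 1).

Record mixed := Mixed {
  mixed_val :> {ffun 'I_m.+1 -> R};
  mixedP : is_mixed mixed_val }.

HB.instance Definition _ := [isSub for mixed_val].
HB.instance Definition _ := [Choice of mixed by <:].

Lemma mixed_ge0 (s : mixed) a : 0 <= s a.
Proof. by have /andP[/forallP] := mixedP s. Qed.

Lemma mixed_sum1 (s : mixed) : \sum_a s a = 1.
Proof. by have /andP[_ /eqP] := mixedP s. Qed.

Lemma is_mixed_pure (a : 'I_m.+1) : is_mixed [ffun b => (b == a)%:R].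
Proof.
apply/andP; split; first by apply/forallP => b; rewrite ffunE ler0n.
rewrite (bigD1 a)//= ffunE eqxx big1 ?addr0// => b /negPf ba.
by rewrite ffunE ba.
Qed.

Definition pure (a : 'I_m.+1) : mixed := Mixed (is_mixed_pure a).

HB.instance Definition _ := isPointed.Build mixed (pure ord0).

Definition mixed_cylinders : set (set mixed) :=
  \bigcup_(a in [set: 'I_m.+1])
    preimage_set_system setT (fun s : mixed => s a) measurable.

HB.instance Definition _ :=
  Measurable.copy mixed (g_sigma_algebraType mixed_cylinders).

Lemma is_mixed_perm (r : {perm 'I_m.+1}) (s : mixed) :
  is_mixed [ffun a => s ((r^-1)%g a)].
Proof.
apply/andP; split; first by apply/forallP => a; rewrite ffunE mixed_ge0.
rewrite -(mixed_sum1 s) [eqbRHS](reindex_inj (@perm_inj _ (r^-1)%g))/=.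
by apply/eqP/eq_bigr => a _; rewrite ffunE.
Qed.

Definition perm_mixed (r : {perm 'I_m.+1}) (s : mixed) : mixed :=
  Mixed (is_mixed_perm r s).

Lemma is_mixed_avg (n : nat) (F : {perm 'I_n.+1} -> mixed) :
  is_mixed [ffun a => (n.+1`!%:R)^-1 * \sum_(r : {perm 'I_n.+1}) F r a].
Proof.
apply/andP; split.
  apply/forallP => a; rewrite ffunE mulr_ge0 ?invr_ge0 ?ler0n// sumr_ge0// => r _.
  exact: mixed_ge0.
under eq_bigr do rewrite ffunE.
rewrite -mulr_sumr exchange_big/=.
under eq_bigr do rewrite mixed_sum1.
rewrite sumr_const card_Sn mulVf// pnatr_eq0 -lt0n fact_gt0.
Qed.

Definition avg_mixed (n : nat) (F : {perm 'I_n.+1} -> mixed) : mixed :=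
  Mixed (is_mixed_avg F).

End Mixed.

Section Games.
Variables (R : realType) (m1 m2 : nat).
Local Notation payoff := (payoff R m1 m2).
Local Notation strategy := (mixed R m1 * mixed R m2)%type.

Definition expected_payoff (A : 'M[R]_(m1.+1, m2.+1)) (s : strategy) : R :=
  \sum_a1 \sum_a2 s.1 a1 * s.2 a2 * A a1 a2.

(* The default of the iterated maximum is one of its values, so this is the
   maximum over the (nonempty) action set. *)
Definition exploitability1 (s : strategy) (u : payoff) : R :=
  (\big[Num.max/expected_payoff u.1 (pure R ord0, s.2)]_(a1 : 'I_m1.+1)
    expected_payoff u.1 (pure R a1, s.2)) - expected_payoff u.1 s.

Definition exploitability2 (s : strategy) (u : payoff) : R :=
  (\big[Num.max/expected_payoff u.2 (s.1, pure R ord0)]_(a2 : 'I_m2.+1)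
    expected_payoff u.2 (s.1, pure R a2)) - expected_payoff u.2 s.

Definition total_exploitability (s : strategy) (u : payoff) : R :=
  exploitability1 s u + exploitability2 s u.

Lemma is_payoff_perm1 (r : {perm 'I_m1.+1}) (u : payoff) :
  is_payoff (\matrix_(a1, a2) u.1 ((r^-1)%g a1) a2,
             \matrix_(a1, a2) u.2 ((r^-1)%g a1) a2).
Proof.
apply/forallP => a1; apply/forallP => a2; rewrite !mxE.
by have /forallP/(_ ((r^-1)%g a1))/forallP/(_ a2) := payoffP u.
Qed.

Definition perm_payoff1 (r : {perm 'I_m1.+1}) (u : payoff) : payoff :=
  Payoff (is_payoff_perm1 r u).

Lemma is_payoff_perm2 (r : {perm 'I_m2.+1}) (u : payoff) :
  is_payoff (\matrix_(a1, a2) u.1 a1 ((r^-1)%g a2),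
             \matrix_(a1, a2) u.2 a1 ((r^-1)%g a2)).
Proof.
apply/forallP => a1; apply/forallP => a2; rewrite !mxE.
by have /forallP/(_ a1)/forallP/(_ ((r^-1)%g a2)) := payoffP u.
Qed.

Definition perm_payoff2 (r : {perm 'I_m2.+1}) (u : payoff) : payoff :=
  Payoff (is_payoff_perm2 r u).

Definition permutation_invariant (D : probability payoff R) : Prop :=
  (forall (r : {perm 'I_m1.+1}) (B : set payoff), measurable B ->
     pushforward D (perm_payoff1 r) B = D B) /\
  (forall (r : {perm 'I_m2.+1}) (B : set payoff), measurable B ->
     pushforward D (perm_payoff2 r) B = D B).

Definition approximator := payoff -> strategy.

Definition orbit_O1 (f : approximator) : approximator := fun u =>
  ((f u).1, avg_mixed (fun r : {perm 'I_m1.+1} => (f (perm_payoff1 r u)).2)).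

Definition orbit_O2 (f : approximator) : approximator := fun u =>
  (avg_mixed (fun r : {perm 'I_m2.+1} => (f (perm_payoff2 r u)).1), (f u).2).

Definition orbit_P1 (f : approximator) : approximator := fun u =>
  (avg_mixed (fun r : {perm 'I_m1.+1} =>
     perm_mixed (r^-1)%g (f (perm_payoff1 r u)).1), (f u).2).

Definition orbit_P2 (f : approximator) : approximator := fun u =>
  ((f u).1, avg_mixed (fun r : {perm 'I_m2.+1} =>
     perm_mixed (r^-1)%g (f (perm_payoff2 r u)).2)).

Definition orbit_O (f : approximator) : approximator := orbit_O1 (orbit_O2 f).

Definition orbit_P (f : approximator) : approximator := orbit_P1 (orbit_P2 f).

End Games.

(* Main.v *)
(** In a constant-sum game the terms [- u_i(s)] of the total exploitability add
    up to a quantity independent of the strategies, leaving the best-response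
    value of player 1 against [s.2] plus that of player 2 against [s.1].  Each
    best-response value is a maximum of linear functions, hence convex in the
    single strategy it depends on; it does not change when the best responder's
    actions are permuted, and permuting the opponent's actions in the payoff
    amounts to permuting the opponent's strategy back.  Jensen's inequality
    thus bounds its value at an orbit average by the average over the orbit of
    its values at [f], and by invariance of [D] every term of the latter has
    the same expectation as the value at [f] itself. *)

Require Import Defs.
From HB Require Import structures.
From mathcomp Require Import all_boot all_order all_algebra.
From mathcomp Require Import fingroup perm.
From mathcomp Require Import all_classical all_reals all_analysis.
From mathcomp Require Import measurable_realfun.

Set Implicit Arguments.
Unset Strict Implicit.
Unset Printing Implicit Defensive.

Import Order.TTheory GRing.Theory Num.Theory.

Local Open Scope classical_set_scope.
Local Open Scope ring_scope.

(** * Best-response values in a matrix game: convexity, symmetry, measurability *)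

Section BestResponse.
Variables (R : realType) (m n : nat).
Implicit Types (A : 'M[R]_(m.+1, n.+1)) (s : mixed R n) (x : R).

Definition row_payoff A s (a : 'I_m.+1) : R := \sum_b s b * A a b.

(** The best responder is always the row player here; player 2 is covered by passing the transpose
    [u.2^T]. *)
Definition best_response A s : R :=
  \big[Num.max/row_payoff A s ord0]_a row_payoff A s a.

Lemma best_response_leP A s x :
  reflect (forall a, row_payoff A s a <= x) (best_response A s <= x).
Proof.
apply: (iffP (bigmax_leP _ _ _ _)) => [[_ h] a|h]; first exact: h.
by split=> [|a _]; exact: h.
Qed.

Lemma row_payoff_le_best A s a : row_payoff A s a <= best_response A s.
Proof. exact: (le_bigmax _ (row_payoff A s)). Qed.

Lemma row_payoff01 A s a : (forall a b, 0 <= A a b <= 1) ->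
  0 <= row_payoff A s a <= 1.
Proof.
move=> A01; apply/andP; split.
  apply: sumr_ge0 => b _; apply: mulr_ge0; first exact: mixed_ge0.
  by case/andP: (A01 a b).
rewrite -(mixed_sum1 s); apply: ler_sum => b _.
by rewrite ler_piMr ?mixed_ge0//; case/andP: (A01 a b).
Qed.

Lemma best_response01 A s : (forall a b, 0 <= A a b <= 1) ->
  0 <= best_response A s <= 1.
Proof.
move=> A01; apply/andP; split.
  apply: le_trans (row_payoff_le_best A s ord0).
  by case/andP: (row_payoff01 s ord0 A01).
by apply/best_response_leP => a; case/andP: (row_payoff01 s a A01).
Qed.

(** Jensen's inequality for a maximum of linear functions: the payoff of a fixed row is linear in
    the mixed strategy, so at the average it is the average of row payoffs, each at most the
    best-response value. *)
Lemma best_response_avg A (k : nat) (F : {perm 'I_k.+1} -> mixed R n) :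
  best_response A (avg_mixed F) <=
  (k.+1`!%:R)^-1 * \sum_(r : {perm 'I_k.+1}) best_response A (F r).
Proof.
apply/best_response_leP => a.
have -> : row_payoff A (avg_mixed F) a =
    (k.+1`!%:R)^-1 * \sum_(r : {perm 'I_k.+1}) row_payoff A (F r) a.
  rewrite /row_payoff exchange_big/= mulr_sumr; apply: eq_bigr => b _.
  by rewrite ffunE -mulrA mulr_suml.
rewrite ler_wpM2l ?invr_ge0 ?ler0n//.
by apply: ler_sum => r _; exact: row_payoff_le_best.
Qed.

(** Relabelling the rows only reorders the family being maximised. *)
Lemma best_response_perm_row (r : {perm 'I_m.+1}) A s :
  best_response (\matrix_(a, b) A ((r^-1)%g a) b) s = best_response A s.
Proof.
have e a : row_payoff (\matrix_(a, b) A ((r^-1)%g a) b) s a =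
    row_payoff A s ((r^-1)%g a).
  by apply: eq_bigr => b _; rewrite mxE.
apply/eqP; rewrite eq_le; apply/andP; split; apply/best_response_leP => a.
  by rewrite e row_payoff_le_best.
by rewrite -[a](permK r) -e row_payoff_le_best.
Qed.

(** The substitution of [r b] for [b] in each row sum moves the permutation from the matrix to the
    strategy. *)
Lemma best_response_perm_col (r : {perm 'I_n.+1}) A s :
  best_response (\matrix_(a, b) A a ((r^-1)%g b)) s =
  best_response A (perm_mixed (r^-1)%g s).
Proof.
have e a : row_payoff (\matrix_(a, b) A a ((r^-1)%g b)) s a =
    row_payoff A (perm_mixed (r^-1)%g s) a.
  rewrite /row_payoff (reindex_inj (@perm_inj _ r))/=.
  by apply: eq_bigr => b _; rewrite mxE ffunE permK invgK.
by rewrite /best_response e; apply: eq_bigr => a _; rewrite e.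
Qed.

Lemma measurable_best_response d (T : measurableType d)
    (A : T -> 'M[R]_(m.+1, n.+1)) (s : T -> mixed R n) :
  (forall a b, measurable_fun setT (fun t => A t a b)) ->
  (forall b, measurable_fun setT (fun t => s t b)) ->
  measurable_fun setT (fun t => best_response (A t) (s t)).
Proof.
move=> mA ms.
have mr a : measurable_fun setT (fun t => row_payoff (A t) (s t) a).
  by apply: measurable_sum => b; exact: measurable_funM.
(* Induction on the list of actions with the default kept fixed; the empty list leaves that default,
   itself a row payoff. *)
rewrite /best_response; elim: (index_enum _) => [|a l IH].
  by under eq_fun do rewrite big_nil; exact: mr.
by under eq_fun do rewrite big_cons; exact: measurable_maxr.
Qed.

End BestResponse.

(** * Measurability of payoffs, and exploitability in terms of best responses *)

Section Games.
Variables (R : realType) (m1 m2 : nat).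
Local Notation payoff := (payoff R m1 m2).

Lemma measurable_payoff1 a b : measurable_fun setT (fun u : payoff => u.1 a b).
Proof.
by move=> _ B mB; apply: sub_sigma_algebra; exists (a, b) => //; left; exists B.
Qed.

Lemma measurable_payoff2 a b : measurable_fun setT (fun u : payoff => u.2 a b).
Proof.
by move=> _ B mB; apply: sub_sigma_algebra; exists (a, b) => //; right; exists B.
Qed.

Lemma measurable_mixed n a : measurable_fun setT (fun s : mixed R n => s a).
Proof.
by move=> _ B mB; apply: sub_sigma_algebra; exists a => //; exists B.
Qed.

(** The sigma-algebra is generated by the coordinate maps, so preimages of the generators
    suffice. *)
Lemma measurable_fun_payoff d (T : measurableType d) (h : T -> payoff) :
  (forall a b, measurable_fun setT (fun t => (h t).1 a b)) ->
  (forall a b, measurable_fun setT (fun t => (h t).2 a b)) ->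
  measurable_fun setT h.
Proof.
move=> h1 h2; apply: (measurability (@payoff_cylinders R m1 m2)) => //.
move=> _ [_ [[a b] _ [[B mB <-]|[B mB <-]]] <-].
  have := h1 a b measurableT B mB; by rewrite !setTI.
have := h2 a b measurableT B mB; by rewrite !setTI.
Qed.

Lemma measurable_perm_payoff1 (r : {perm 'I_m1.+1}) :
  measurable_fun setT (@perm_payoff1 R m1 m2 r).
Proof.
apply: measurable_fun_payoff => a b /=; under eq_fun do rewrite mxE.
  exact: measurable_payoff1.
exact: measurable_payoff2.
Qed.

Lemma measurable_perm_payoff2 (r : {perm 'I_m2.+1}) :
  measurable_fun setT (@perm_payoff2 R m1 m2 r).
Proof.
apply: measurable_fun_payoff => a b /=; under eq_fun do rewrite mxE.
  exact: measurable_payoff1.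
exact: measurable_payoff2.
Qed.

Lemma payoff01 (u : payoff) a b : 0 <= u.1 a b <= 1 /\ 0 <= u.2 a b <= 1.
Proof. by have /forallP/(_ a)/forallP/(_ b)/andP := payoffP u. Qed.

Lemma sum_pure n (a : 'I_n.+1) (F : 'I_n.+1 -> R) :
  \sum_b pure R a b * F b = F a.
Proof.
rewrite (bigD1 a)//= ffunE eqxx mul1r big1 ?addr0// => b /negPf ba.
by rewrite ffunE ba mul0r.
Qed.

Lemma total_exploitabilityE (s : mixed R m1 * mixed R m2) (u : payoff) :
  total_exploitability s u =
  best_response u.1 s.2 + best_response u.2^T s.1 -
  (expected_payoff u.1 s + expected_payoff u.2 s).
Proof.
have e1 a : expected_payoff u.1 (pure R a, s.2) = row_payoff u.1 s.2 a.
  rewrite /expected_payoff /= -[RHS](sum_pure a (row_payoff u.1 s.2)).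
  by apply: eq_bigr => b _; rewrite mulr_sumr; under eq_bigr do rewrite -mulrA.
have e2 a : expected_payoff u.2 (s.1, pure R a) = row_payoff u.2^T s.1 a.
  rewrite /expected_payoff /=; apply: eq_bigr => b _; rewrite mxE.
  under eq_bigr do rewrite -mulrA.
  by rewrite -mulr_sumr sum_pure.
rewrite /total_exploitability /exploitability1 /exploitability2 /best_response.
rewrite e1 e2; under eq_bigr do rewrite e1.
under [X in _ + (X - _)]eq_bigr do rewrite e2.
by rewrite addrACA -opprD.
Qed.

(** The unknown constant is expressed by the entries at [ord0], which makes it a measurable function
    of [u], bounded on all payoffs. *)
Lemma expected_payoff_const (s : mixed R m1 * mixed R m2) (u : payoff) :
  constant_sum u ->
  expected_payoff u.1 s + expected_payoff u.2 s = u.1 ord0 ord0 + u.2 ord0 ord0.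
Proof.
move=> [c uc]; rewrite uc -big_split/=.
under eq_bigr do rewrite -big_split/=.
under eq_bigr do under eq_bigr do rewrite -mulrDr uc.
under eq_bigr do rewrite -mulr_suml -mulr_sumr mixed_sum1 mulr1.
by rewrite -mulr_suml mixed_sum1 mul1r.
Qed.

End Games.

(** * Integrals under measure-preserving maps *)

Section Averaging.
Context d (T : measurableType d) (R : realType) (P : probability T R).
Local Open Scope ereal_scope.

Lemma integrable_unit_interval (g : T -> R) : measurable_fun setT g ->
  (forall t, 0 <= g t <= 1)%R -> P.-integrable setT (EFin \o g).
Proof.
move=> mg g01; apply: measurable_bounded_integrable => //.
  by apply: (le_lt_trans (probability_le1 P measurableT)); rewrite ltry.
exists 1%R; split=> // x x1 t _ /=.
by case/andP: (g01 t) => g0 g1; rewrite ger0_norm// (le_trans g1)// ltW.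
Qed.

Lemma integral_invariant (h : T -> T) (g : T -> R) :
  measurable_fun setT h -> (forall B, measurable B -> pushforward P h B = P B) ->
  measurable_fun setT g -> (forall t, 0 <= g t)%R ->
  \int[P]_t (g (h t))%:E = \int[P]_t (g t)%:E.
Proof.
move=> mh hP mg g0.
rewrite -(@ge0_integral_pushforward _ _ _ _ _ _ mh P setT (EFin \o g))//=.
- by apply: eq_measure_integral => B mB _; exact: hP.
- exact/measurable_EFinP.
- by move=> t _ /=; rewrite lee_fin.
Qed.

Lemma integral_orbit_average (k : nat) (h : {perm 'I_k.+1} -> T -> T)
    (g g' : T -> R) :
  (forall r, measurable_fun setT (h r)) ->
  (forall r B, measurable B -> pushforward P (h r) B = P B) ->
  measurable_fun setT g -> (forall t, 0 <= g t)%R ->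
  measurable_fun setT g' -> (forall t, 0 <= g' t)%R ->
  (forall t, g' t <= (k.+1`!%:R)^-1 * \sum_(r : {perm 'I_k.+1}) g (h r t))%R ->
  \int[P]_t (g' t)%:E <= \int[P]_t (g t)%:E.
Proof.
move=> mh hP mg g0 mg' g'0 g'g.
have mgh r : measurable_fun setT (fun t => (g (h r t))%:E).
  by apply/measurable_EFinP; exact: (measurableT_comp mg (mh r)).
have cge0 : (0 <= (k.+1`!%:R : R)^-1)%R by rewrite invr_ge0 ler0n.
have mS : measurable_fun setT
    (fun t => \sum_(r : {perm 'I_k.+1}) (g (h r t))%:E).
  by apply: emeasurable_sum.
apply: (@le_trans _ _ (\int[P]_t (((k.+1`!%:R)^-1)%:E *
    \sum_(r : {perm 'I_k.+1}) (g (h r t))%:E))).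
  apply: ge0_le_integral => //.
  - by move=> t _; rewrite lee_fin.
  - exact/measurable_EFinP.
  - exact: measurable_funeM.
  - by move=> t _; rewrite sumEFin -EFinM lee_fin.
rewrite ge0_integralZl_EFin//; last first.
  by move=> t _; apply: sume_ge0 => r _; rewrite lee_fin.
rewrite ge0_integral_sum//; last by move=> r t _; rewrite lee_fin.
rewrite (eq_bigr (fun=> \int[P]_t (g t)%:E)); last first.
  by move=> r _; apply: integral_invariant => //; exact: hP.
rewrite sumr_const card_Sn.
have -> : ((\int[P]_t (g t)%:E)%E *+ k.+1`!)%R =
    (k.+1`!%:R)%:E * \int[P]_t (g t)%:E by rewrite mule_natl.
rewrite muleA -EFinM mulVf ?mul1e// pnatr_eq0 -lt0n fact_gt0.
Qed.

End Averaging.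

(** * Expected exploitability before and after orbit averaging *)

Section Comparison.
Variables (R : realType) (m1 m2 : nat).
Local Notation payoff := (payoff R m1 m2).
Local Notation approximator := (approximator R m1 m2).
Variable D : probability payoff R.

(** Measurability is stated coordinatewise because finite averages visibly preserve this form. *)
Definition measurable_coords (f : approximator) : Prop :=
  (forall a, measurable_fun setT (fun u : payoff => (f u).1 a)) /\
  (forall a, measurable_fun setT (fun u : payoff => (f u).2 a)).

Lemma measurable_avg_mixed n k (F : payoff -> {perm 'I_k.+1} -> mixed R n) a :
  (forall r, measurable_fun setT (fun u : payoff => F u r a)) ->
  measurable_fun setT (fun u : payoff => avg_mixed (F u) a).
Proof.
move=> mF; under eq_fun do rewrite ffunE.
by apply: measurable_funM => //; exact: measurable_sum.
Qed.

Lemma measurable_best1 (f : approximator) : measurable_coords f ->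
  measurable_fun setT (fun u : payoff => best_response u.1 (f u).2).
Proof.
case=> _ mf; apply: measurable_best_response => // a b.
exact: measurable_payoff1.
Qed.

Lemma measurable_best2 (f : approximator) : measurable_coords f ->
  measurable_fun setT (fun u : payoff => best_response u.2^T (f u).1).
Proof.
case=> mf _; apply: measurable_best_response => // a b.
under eq_fun do rewrite mxE.
exact: measurable_payoff2.
Qed.

Lemma best1_01 (f : approximator) (u : payoff) : 0 <= best_response u.1 (f u).2 <= 1.
Proof. by apply: best_response01 => a b; case: (payoff01 u a b). Qed.

Lemma best2_01 (f : approximator) (u : payoff) : 0 <= best_response u.2^T (f u).1 <= 1.
Proof. by apply: best_response01 => a b; rewrite mxE; case: (payoff01 u b a). Qed.

Lemma measurable_expected_payoff (f : approximator) : measurable_coords f ->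
  measurable_fun setT
    (fun u : payoff => expected_payoff u.1 (f u) + expected_payoff u.2 (f u)).
Proof.
case=> mf1 mf2; apply: measurable_funD;
  apply: measurable_sum => a; apply: measurable_sum => b;
  apply: measurable_funM => //; try exact: measurable_funM.
  exact: measurable_payoff1.
exact: measurable_payoff2.
Qed.

(** All values split off lie in [0,1], hence are integrable. The subtracted term does not involve
    [f], so comparing two approximators reduces to comparing their best-response integrals. *)
Lemma expectation_total_exploitability (f : approximator) :
  {ae D, forall u, constant_sum u} -> measurable_coords f ->
  ('E_D[fun u => total_exploitability (f u) u] =
   \int[D]_u (best_response u.1 (f u).2)%:E +
   \int[D]_u (best_response u.2^T (f u).1)%:E -
   (\int[D]_u (u.1 ord0 ord0)%:E + \int[D]_u (u.2 ord0 ord0)%:E))%E.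
Proof.
move=> hcs mf.
have m1f := measurable_best1 mf; have m2f := measurable_best2 mf.
have i1 := integrable_unit_interval D m1f (best1_01 f).
have i2 := integrable_unit_interval D m2f (best2_01 f).
have mc1 : measurable_fun setT (fun u : payoff => u.1 ord0 ord0).
  exact: measurable_payoff1.
have mc2 : measurable_fun setT (fun u : payoff => u.2 ord0 ord0).
  exact: measurable_payoff2.
have j1 := integrable_unit_interval D mc1 (fun u => (payoff01 u _ _).1).
have j2 := integrable_unit_interval D mc2 (fun u => (payoff01 u _ _).2).
rewrite -(integralD measurableT i1 i2) -(integralD measurableT j1 j2).
rewrite -(integralB measurableT (integrableD measurableT i1 i2)
  (integrableD measurableT j1 j2)).
rewrite unlock; apply: ae_eq_integral => //.
(* Measurability is needed on all payoffs, including those that are not constant-sum, so the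
   expected payoffs are kept here. *)
- apply/measurable_EFinP; under eq_fun do rewrite total_exploitabilityE.
  apply: measurable_funB; first exact: measurable_funD.
  exact: measurable_expected_payoff.
- apply: emeasurable_funB; apply: emeasurable_funD; exact/measurable_EFinP.
- apply: filterS hcs => u uc _ /=.
  by rewrite total_exploitabilityE expected_payoff_const.
Qed.

Lemma expectation_exploitability_le (f g : approximator) :
  {ae D, forall u, constant_sum u} ->
  measurable_coords f -> measurable_coords g ->
  (\int[D]_u (best_response u.1 (g u).2)%:E <=
    \int[D]_u (best_response u.1 (f u).2)%:E)%E ->
  (\int[D]_u (best_response u.2^T (g u).1)%:E <=
    \int[D]_u (best_response u.2^T (f u).1)%:E)%E ->
  ('E_D[fun u => total_exploitability (g u) u] <=
    'E_D[fun u => total_exploitability (f u) u])%E.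
Proof.
move=> hcs mf mg le1 le2.
by rewrite !expectation_total_exploitability// leeB// leeD.
Qed.

(** The two averagings change different components, so each component of the composite is a single
    average of values of [f]. *)
Lemma measurable_orbit_O (f : approximator) :
  measurable_coords f -> measurable_coords (orbit_O f).
Proof.
case=> mf1 mf2; split=> a; apply: measurable_avg_mixed => r.
  exact: (measurableT_comp (mf1 a) (measurable_perm_payoff2 r)).
exact: (measurableT_comp (mf2 a) (measurable_perm_payoff1 r)).
Qed.

Lemma measurable_orbit_P (f : approximator) :
  measurable_coords f -> measurable_coords (orbit_P f).
Proof.
case=> mf1 mf2; split=> a; apply: measurable_avg_mixed => r.
  under eq_fun do rewrite ffunE.
  exact: (measurableT_comp (mf1 _) (measurable_perm_payoff1 r)).
under eq_fun do rewrite ffunE.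
exact: (measurableT_comp (mf2 _) (measurable_perm_payoff2 r)).
Qed.

Hypothesis hinv : permutation_invariant D.

(** In the assumed bound both the game and the argument of [f] are [h r u], so every summand is one
    fixed function composed with [h r], as invariance requires. *)
Lemma integral_best1_le k (h : {perm 'I_k.+1} -> payoff -> payoff)
    (f g : approximator) :
  (forall r, measurable_fun setT (h r)) ->
  (forall r B, measurable B -> pushforward D (h r) B = D B) ->
  measurable_coords f -> measurable_coords g ->
  (forall u : payoff, best_response u.1 (g u).2 <= (k.+1`!%:R)^-1 *
    \sum_(r : {perm 'I_k.+1}) best_response (h r u).1 (f (h r u)).2) ->
  (\int[D]_u (best_response u.1 (g u).2)%:E <=
    \int[D]_u (best_response u.1 (f u).2)%:E)%E.
Proof.
move=> mh hD mf mg; apply: (integral_orbit_average mh hD).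
- exact: measurable_best1.
- by move=> u; case/andP: (best1_01 f u).
- exact: measurable_best1.
- by move=> u; case/andP: (best1_01 g u).
Qed.

Lemma integral_best2_le k (h : {perm 'I_k.+1} -> payoff -> payoff)
    (f g : approximator) :
  (forall r, measurable_fun setT (h r)) ->
  (forall r B, measurable B -> pushforward D (h r) B = D B) ->
  measurable_coords f -> measurable_coords g ->
  (forall u : payoff, best_response u.2^T (g u).1 <= (k.+1`!%:R)^-1 *
    \sum_(r : {perm 'I_k.+1}) best_response (h r u).2^T (f (h r u)).1) ->
  (\int[D]_u (best_response u.2^T (g u).1)%:E <=
    \int[D]_u (best_response u.2^T (f u).1)%:E)%E.
Proof.
move=> mh hD mf mg; apply: (integral_orbit_average mh hD).
- exact: measurable_best2.
- by move=> u; case/andP: (best2_01 f u).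
- exact: measurable_best2.
- by move=> u; case/andP: (best2_01 g u).
Qed.

Lemma best1_perm_payoff1 r (u : payoff) s :
  best_response (perm_payoff1 r u).1 s = best_response u.1 s.
Proof. exact: best_response_perm_row. Qed.

Lemma best1_perm_payoff2 r (u : payoff) s :
  best_response (perm_payoff2 r u).1 s =
  best_response u.1 (perm_mixed (r^-1)%g s).
Proof. exact: best_response_perm_col. Qed.

Lemma best2_perm_payoff1 r (u : payoff) s :
  best_response (perm_payoff1 r u).2^T s =
  best_response u.2^T (perm_mixed (r^-1)%g s).
Proof.
rewrite -best_response_perm_col; congr best_response.
by apply/matrixP => b a; rewrite !mxE.
Qed.

Lemma best2_perm_payoff2 r (u : payoff) s :
  best_response (perm_payoff2 r u).2^T s = best_response u.2^T s.
Proof.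
rewrite -[RHS](best_response_perm_row r); congr best_response.
by apply/matrixP => b a; rewrite !mxE.
Qed.

(** Each strategy is averaged over relabellings of the opponent's actions. The opponent is the best
    responder against it, so these relabellings leave the best-response value unchanged. *)
Lemma expectation_orbit_O (f : approximator) :
  {ae D, forall u, constant_sum u} -> measurable_coords f ->
  ('E_D[fun u => total_exploitability (orbit_O f u) u] <=
    'E_D[fun u => total_exploitability (f u) u])%E.
Proof.
move=> hcs mf; have mOf := measurable_orbit_O mf.
apply: expectation_exploitability_le => //.
- apply: (integral_best1_le (@measurable_perm_payoff1 R m1 m2) hinv.1) => // u.
  under eq_bigr do rewrite best1_perm_payoff1.
  exact: best_response_avg.
- apply: (integral_best2_le (@measurable_perm_payoff2 R m1 m2) hinv.2) => // u.
  under eq_bigr do rewrite best2_perm_payoff2.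
  exact: best_response_avg.
Qed.

(** Each strategy is averaged over relabellings of its owner's actions. Undoing the relabelling by
    [r^-1] in the strategy gives against [u] the value that the original strategy has in the
    relabelled game. *)
Lemma expectation_orbit_P (f : approximator) :
  {ae D, forall u, constant_sum u} -> measurable_coords f ->
  ('E_D[fun u => total_exploitability (orbit_P f u) u] <=
    'E_D[fun u => total_exploitability (f u) u])%E.
Proof.
move=> hcs mf; have mPf := measurable_orbit_P mf.
apply: expectation_exploitability_le => //.
- apply: (integral_best1_le (@measurable_perm_payoff2 R m1 m2) hinv.2) => // u.
  under eq_bigr do rewrite best1_perm_payoff2.
  exact: best_response_avg.
- apply: (integral_best2_le (@measurable_perm_payoff1 R m1 m2) hinv.1) => // u.
  under eq_bigr do rewrite best2_perm_payoff1.
  exact: best_response_avg.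
Qed.

End Comparison.

Theorem theorem4p7 (R : realType) (m1 m2 : nat)
    (D : probability (payoff R m1 m2) R)
    (hcs : {ae D, forall u, constant_sum u})
    (hinv : permutation_invariant D)
    (X : approximator R m1 m2 -> approximator R m1 m2)
    (hX : X = @orbit_O R m1 m2 \/ X = @orbit_P R m1 m2)
    (f : approximator R m1 m2)
    (hf : measurable_fun [set: payoff R m1 m2] f) :
  ('E_D[fun u => total_exploitability (X f u) u]
     <= 'E_D[fun u => total_exploitability (f u) u])%E.
Proof.
have mf : measurable_coords f.
  split=> a.
    apply: (measurableT_comp (measurable_mixed a)).
    exact: (measurableT_comp measurable_fst hf).
  apply: (measurableT_comp (measurable_mixed a)).
  exact: (measurableT_comp measurable_snd hf).
case: hX => ->.
  exact: expectation_orbit_O.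
exact: expectation_orbit_P.
Qed.
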